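(* Let $T\in B(H)^n$ be a commuting tuple that is finitely generated and $\gamma$-graded. Let $0\le k_1<k_2<\ldots<k_r$ and $N_1,\ldots,N_r\ge1$ be integers, and let $x^s_j\in H_{k_s}$ ($1\le s\le r$, $1\le j\le N_s$) be non-zero homogeneous vectors generating the $\mathbb C[z]$-module $\tilde H$. For $s=1,2,\ldots,r$ successively, define a finite (possibly empty) set $B_s\subset H_{k_s}$ as follows. Put $$Y_s=\{T^\alpha y:\ 1\le p<s,\ y\in B_p,\ \alpha\in\mathbb N^n \text{ with }\langle\alpha,\gamma\rangle=k_s-k_p\}.$$ If $x^s_1,\ldots,x^s_{N_s}\in\operatorname{span}Y_s$, let $B_s=\emptyset$. Otherwise let $B_s=\{y^s_1,\ldots,y^s_{n_s}\}$ be the set of those non-zero vectors which the Gram–Schmidt orthogonalization procedure, applied to an enumeration of $Y_s$ followed by $x^s_1,\ldots,x^s_{N_s}$, produces from the vectors $x^s_1,\ldots,x^s_{N_s}$; thus the vectors in $B_s$ are pairwise orthogonal, non-zero, orthogonal to $Y_s$, and $\operatorname{span}(Y_s\cup B_s)=\operatorname{span}(Y_s\cup\{x^s_1,\ldots,x^s_{N_s}\})$. Then: (a) The set $B=B_1\cup\ldots\cup B_r$ is an orthogonal basis of $W_T(H)$ and is a minimal generating set for the $\mathbb C[z]$-module $\tilde H$, consisting of homogeneous elements. (b) If for each $s$ one lets $X'_s\subset\{x^s_1,\ldots,x^s_{N_s}\}$ be the set of those $x^s_{j}$ with $x^s_j\notin\operatorname{span}(Y_s\cup\{x^s_1,\ldots,x^s_{j-1}\})$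 (i.e. the vectors $x^s_{i_1},\ldots,x^s_{i_{n_s}}$ from which the Gram–Schmidt procedure produces the vectors $y^s_1,\ldots,y^s_{n_s}$), then $X'_1\cup\ldots\cup X'_r$ is a minimal generating set for the $\mathbb C[z]$-module $\tilde H$ contained in the original set of generators.
   Context: $\mathbb N=\{0,1,2,\ldots\}$, $\mathbb C[z]=\mathbb C[z_1,\ldots,z_n]$. $H$ is a complex Hilbert space with a fixed orthogonal decomposition into closed subspaces $H_k$ ($k\in\mathbb N$), i.e. $H$ is the Hilbert space orthogonal direct sum of the $H_k$; $\gamma=(\gamma_1,\ldots,\gamma_n)$ is a tuple of integers $\gamma_i>0$ and $\langle\alpha,\gamma\rangle=\sum_{i=1}^n\alpha_i\gamma_i$ for $\alpha\in\mathbb N^n$. Elements of some $H_k$ are called homogeneous. A commuting tuple $T\in B(H)^n$ is finitely generated and $\gamma$-graded if $T_iH_k\subset H_{k+\gamma_i}$ for all $k\in\mathbb N$, $i=1,\ldots,n$, and the algebraic direct sum $\tilde H=\bigoplus_{k\ge0}H_k$ is a finitely generated $\mathbb C[z]$-module with respect to $(p,x)\mapsto p(T)x$. $W_T(H)=H\ominus\sum_{i=1}^nT_iH$ is the orthogonal complement of $\sum_iT_iH$ in $H$. A minimal generating set is a generating set whose number of elements is the smallest possible among all generating sets of the module. In the Gram–Schmidt procedure vectors that are linearly dependent on their predecessors are discarded. *)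

(* Defs.v *)
From HB Require Import structures.
From mathcomp Require Import all_boot all_order all_algebra.
From mathcomp Require Import complex.
From mathcomp Require mpoly.
Import (coercions) mpoly.
From mathcomp Require Import all_classical all_reals all_analysis.

Set Implicit Arguments.
Unset Strict Implicit.
Unset Printing Implicit Defensive.

Import Order.TTheory GRing.Theory Num.Theory.
Import numFieldNormedType.Exports.

Local Open Scope classical_set_scope.
Local Open Scope ring_scope.

Section Hilbert.
Context {R : realType} {H : completeNormedModType R[i]}.
Implicit Types (dot : {dot H for @Num.conj R[i]}) (S E B : set H).

Definition hilbert_norm dot := forall x : H, `|x| ^+ 2 = dot x x.

Definition subspace E :=
  E 0 /\ forall (a : R[i]) u v, E u -> E v -> E (a *: u + v).

Definition lspan S : set H :=
  [set v | exists m (c : 'I_m -> R[i]) (g : 'I_m -> H),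
      (forall i, S (g i)) /\ v = \sum_i c i *: g i].

Definition lin_indep S :=
  forall m (c : 'I_m -> R[i]) (g : 'I_m -> H),
    injective g -> (forall i, S (g i)) -> \sum_i c i *: g i = 0 ->
    forall i, c i = 0.

Definition orthogonal_basis dot B E :=
  [/\ lin_indep B, lspan B = E &
      forall u v, B u -> B v -> u <> v -> dot u v = 0].

Definition orthogonal_complement dot S : set H :=
  [set w | forall v, S v -> dot w v = 0].

(* Every x is the norm limit of a series of components x_k in H_k; uniqueness
   of the components follows from orthogonality. *)
Definition hilbert_direct_sum dot (Hk : nat -> set H) :=
  [/\ forall k, subspace (Hk k) /\ closed (Hk k),
      forall k l u v, k <> l -> Hk k u -> Hk l v -> dot u v = 0 &
      forall x : H, exists u : nat -> H,
        (forall k, Hk k (u k)) /\ series u @ \oo --> x].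

Definition algebraic_sum (Hk : nat -> set H) : set H :=
  [set x | exists N (u : nat -> H),
      (forall k, Hk k (u k)) /\ x = \sum_(k < N) u k].

Definition homogeneous (Hk : nat -> set H) (x : H) := exists k, Hk k x.

Definition gs_residual dot (es : seq H) (v : H) : H :=
  v - \sum_(e <- es) (dot v e / dot e e) *: e.

(* The vectors that the Gram-Schmidt procedure, having already produced the
   pairwise orthogonal non-zero vectors es, produces from vs. *)
Fixpoint gram_schmidt dot (es vs : seq H) : seq H :=
  if vs is v :: vs' then
    let w := gs_residual dot es v in
    if w == 0 then gram_schmidt dot es vs'
    else w :: gram_schmidt dot (rcons es w) vs'
  else [::].

Lemma gram_schmidt_cat dot es us vs :
  gram_schmidt dot es (us ++ vs) =
  let fs := gram_schmidt dot es us in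
  fs ++ gram_schmidt dot (es ++ fs) vs.
Proof.
elim: us es => [|u us IH] es /=; first by rewrite cats0.
by case: eqP => _; rewrite IH //= -cats1 -catA.
Qed.

End Hilbert.

Section Tuple.
Context {R : realType} {H : completeNormedModType R[i]} {n : nat}.
Variables (T : 'I_n -> {linear H -> H}).

(* T^alpha = T_1^alpha_1 ... T_n^alpha_n, in this order of composition, which
   is immaterial for a commuting tuple. *)
Definition op_pow (alpha : mpoly.multinom n) (x : H) : H :=
  foldr (fun i => iter (alpha i) (T i)) x (enum 'I_n).

(* p(T) x *)
Definition op_eval (p : mpoly.mpoly n R[i]) (x : H) : H :=
  \sum_(m <- mpoly.msupp p) mpoly.mcoeff m p *: op_pow m x.

Definition submodule_gen (G : set H) : set H :=
  [set x | exists m (p : 'I_m -> mpoly.mpoly n R[i]) (g : 'I_m -> H),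
      (forall i, G (g i)) /\ x = \sum_i op_eval (p i) (g i)].

Definition generates (G M : set H) := submodule_gen G = M.

Definition minimal_generating_set (G M : set H) :=
  generates G M /\ forall G' : set H, generates G' M -> (G #<= G')%card.

Definition commuting_tuple := forall i j x, T i (T j x) = T j (T i x).

Definition bounded_tuple := forall i, bounded_near (T i) (nbhs (0 : H)).

Definition weight (gamma : 'I_n -> nat) (alpha : mpoly.multinom n) : nat :=
  (\sum_i alpha i * gamma i)%N.

Definition fg_graded (gamma : 'I_n -> nat) (Hk : nat -> set H) :=
  (forall k i x, Hk k x -> Hk (k + gamma i)%N (T i x)) /\
  exists2 F : set H, finite_set F & generates F (algebraic_sum Hk).

Definition sum_range : set H :=
  [set x | exists h : 'I_n -> H, x = \sum_i T i (h i)].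

Definition wandering dot : set H := orthogonal_complement dot sum_range.

Section Construction.
Variables (dot : {dot H for @Num.conj R[i]}) (gamma : 'I_n -> nat).
Variables (r : nat) (k : 'I_r -> nat) (N : 'I_r -> nat).
Variables (B : 'I_r -> set H).

Definition Yset (s : 'I_r) : set H :=
  [set v | exists (p : 'I_r) (y : H) (alpha : mpoly.multinom n),
      [/\ (p < s)%N, B p y, (k p + weight gamma alpha)%N = k s &
          v = op_pow alpha y]].

(* ys enumerates Y_s; gram_schmidt [::] ys are the vectors produced from Y_s.
   Since Y_s only involves B_p with p < s, this determines B by recursion. *)
Definition constructed (x : forall s : 'I_r, 'I_(N s) -> H) :=
  forall s : 'I_r,
    let Y := Yset s in
    ((forall j, lspan Y (x s j)) -> B s = set0) /\
    (~ (forall j, lspan Y (x s j)) ->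
     exists ys : seq H, [set` ys] = Y /\
       B s = [set` gram_schmidt dot (gram_schmidt dot [::] ys)
                                    [seq x s j | j <- enum 'I_(N s)]]).

Definition Xprime (x : forall s : 'I_r, 'I_(N s) -> H) (s : 'I_r) : set H :=
  [set v | exists j : 'I_(N s), v = x s j /\
      ~ lspan (Yset s `|` [set x s i | i in [set i : 'I_(N s) | (i < j)%N]])
              (x s j)].

End Construction.
End Tuple.

(* Main.v *)
Require Import Defs.
From HB Require Import structures.
From mathcomp Require Import all_boot all_order all_algebra.
From mathcomp Require Import complex.
From mathcomp Require mpoly.
Import (coercions, canonicals) mpoly.
From mathcomp Require Import all_classical all_reals all_analysis.

Set Implicit Arguments.
Unset Strict Implicit.
Unset Printing Implicit Defensive.

Import Order.TTheory GRing.Theory Num.Theory.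
Import numFieldNormedType.Exports.

Local Open Scope classical_set_scope.
Local Open Scope ring_scope.

(** Each vector of [B_s] is orthogonal to [Y_s], hence to [T_i u] for homogeneous
[u] of degree [k_s - gamma_i], which lies in the span of the monomials
[T^alpha y] with [y] in an earlier [B_p]; the other degrees are orthogonal for
free, and boundedness of [T_i] passes to all of [H].  So [B] lies in the
wandering space.  A wandering vector minus its projection to the span of [B] is
orthogonal to every [T^alpha y], [y] in [B], hence to a dense subspace, hence 0.
If [G] generates the module, pairing with [B] kills the ranges of the [T_i], so
the vectors of [B] are constant-coefficient combinations of [G] modulo the
orthogonal complement of [B], and a rank comparison gives [#|B| <= #|G|].  The
selected original vectors generate by induction on the degree, and there are as
many of them as Gram-Schmidt outputs. *)

(* The topology library has another [subspace]. *)
Local Notation subspace := Defs.subspace.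

(** * Subspaces and linear spans *)

Section Span.
Context {R : realType} {H : completeNormedModType R[i]}.
Implicit Types (S E : set H).

Lemma subspace_sum E I (r : seq I) (P : pred I) (F : I -> H) :
  subspace E -> (forall i, P i -> E (F i)) -> E (\sum_(i <- r | P i) F i).
Proof.
move=> [E0 EP] EF; elim/big_rec: _ => // i v /EF Ei Ev.
by rewrite -[F i]scale1r; apply: EP.
Qed.

Lemma subspaceZ E a v : subspace E -> E v -> E (a *: v).
Proof. by move=> [E0 EP] Ev; rewrite -[a *: v]addr0; apply: EP. Qed.

Lemma subspaceD E u v : subspace E -> E u -> E v -> E (u + v).
Proof. by move=> [E0 EP] Eu Ev; rewrite -[u]scale1r; apply: EP. Qed.

Lemma subspaceB E u v : subspace E -> E u -> E v -> E (u - v).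
Proof.
by move=> sE Eu Ev; rewrite -scaleN1r; apply: subspaceD => //; apply: subspaceZ.
Qed.

Lemma lspan_min S E : subspace E -> S `<=` E -> lspan S `<=` E.
Proof.
move=> sE SE _ [m [c [g [Sg ->]]]].
by apply: subspace_sum => // i _; apply: subspaceZ => //; exact: SE.
Qed.

Lemma subset_lspan S : S `<=` lspan S.
Proof.
move=> v Sv; exists 1%N, (fun=> 1), (fun=> v); split=> //.
by rewrite big_ord1 scale1r.
Qed.

Lemma subspace_lspan S : subspace (lspan S).
Proof.
split.
  by exists 0%N, (fun=> 0), (fun=> 0); split; [case | rewrite big_ord0].
move=> a _ _ [m [c [g [Sg ->]]]] [m' [c' [g' [Sg' ->]]]].
exists (m + m')%N, (fun i => match fintype.split i with inl j => a * c j | inr j => c' j end),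
  (fun i => match fintype.split i with inl j => g j | inr j => g' j end).
split; first by move=> i; case: fintype.split.
rewrite big_split_ord scaler_sumr; congr (_ + _); apply: eq_bigr => i _.
  by rewrite (unsplitK (inl _ i)) scalerA.
by rewrite (unsplitK (inr _ i)).
Qed.

Lemma lspanS S E : S `<=` E -> lspan S `<=` lspan E.
Proof.
move=> SE; apply: lspan_min; first exact: subspace_lspan.
exact: subset_trans SE (@subset_lspan E).
Qed.

End Span.

(** * Orthogonality, limits and the Gram-Schmidt procedure *)

Section Orthogonality.
Context {R : realType} {H : completeNormedModType R[i]}.
Variable dot : {dot H for @Num.conj R[i]}.
Implicit Types (u v w : H) (es vs : seq H).

Lemma dot_eq0C u v : dot u v = 0 -> dot v u = 0.
Proof. by move/eqP; rewrite herm_eq0C => /eqP. Qed.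

Lemma dot_subspacer w : subspace [set v | dot w v = 0].
Proof.
split=> [|a u v /= u0 v0]; first by rewrite /= linear0r.
by rewrite linearDr linearZr_LR /= u0 v0 mulr0 addr0.
Qed.

Lemma dot_lspan0 w (S : set H) :
  (forall v, S v -> dot w v = 0) -> forall v, lspan S v -> dot w v = 0.
Proof. by move=> w0; apply: lspan_min => //; exact: dot_subspacer. Qed.

(** Pythagoras for [v = c *: b + w] with [w] orthogonal to [b]. This stands in for the
    Cauchy-Schwarz inequality in passing to limits. *)
Lemma orthogonal_proj_le (b v : H) : hilbert_norm dot ->
  `|(dot v b / dot b b) *: b| <= `|v|.
Proof.
move=> hdot; have [->|b0] := eqVneq b 0; first by rewrite scaler0 normr0.
set c := _ / _; pose w := v - c *: b.
have cw : dot (c *: b) w = 0.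
  apply: dot_eq0C; rewrite linearZr_LR /= linearBl linearZl_LR /=.
  by rewrite /c divfK ?dnorm_eq0// subrr mulr0.
rewrite -ler_sqr ?nnegrE// !hdot.
have -> : v = c *: b + w by rewrite addrC subrK.
by rewrite hnormDd// lerDl dnorm_ge0.
Qed.

(** Since every [v_ N] is orthogonal to [b], the vectors [v] and [v - v_ N] have the same projection
    [c *: b]. Were it non-zero, its norm would bound the distance from [v] to [v_ N] away from 0. *)
Lemma dot_cvg0 (b v : H) (v_ : nat -> H) : hilbert_norm dot ->
  v_ @ \oo --> v -> (forall N, dot b (v_ N) = 0) -> dot b v = 0.
Proof.
move=> hdot vv v0; apply: contrapT => /eqP bv0.
have b0 : b != 0 by apply: contra_neq bv0 => ->; rewrite linear0l.
pose c := dot v b / dot b b.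
have c0 : 0 < `|c *: b|.
  by rewrite normr_gt0 scaler_eq0 negb_or b0 andbT mulf_neq0 ?invr_eq0 ?dnorm_eq0//
    herm_eq0C.
move/cvgrPdist_lt/(_ _ c0): vv => [N _ /(_ N (leqnn N))] /=.
apply/negP; rewrite le_gtF//.
have -> : c = dot (v - v_ N) b / dot b b.
  by rewrite linearBl /= (dot_eq0C (v0 N)) subr0.
exact: orthogonal_proj_le.
Qed.

(** Lists keep the order in which Gram-Schmidt works; [uniq] makes the length equal to the number of
    vectors. *)
Definition orthogonal_system es :=
  [/\ uniq es, 0 \notin es & {in es &, forall u v, u != v -> dot u v = 0}].

Lemma orthogonal_system_rcons es w : orthogonal_system es -> w != 0 ->
  {in es, forall e, dot w e = 0} -> orthogonal_system (rcons es w).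
Proof.
move=> [ues es0 oes] w0 ow; split.
- rewrite rcons_uniq ues andbT; apply: contra w0 => /ow/eqP.
  by rewrite dnorm_eq0.
- by rewrite mem_rcons inE eq_sym negb_or w0.
- move=> u v; rewrite !mem_rcons !inE => /predU1P[->|ue] /predU1P[->|ve].
  + by rewrite eqxx.
  + by move=> _; exact: ow.
  + by move=> _; apply/dot_eq0C/ow.
  + exact: oes.
Qed.

Lemma gs_residual_orthogonal es v : orthogonal_system es ->
  {in es, forall e, dot (gs_residual dot es v) e = 0}.
Proof.
move=> [ues es0 oes] e ee; rewrite /gs_residual linearBl /= linear_sumlz.
rewrite (bigD1_seq e)//= big_seq_cond big1 => [|f /andP[fe fNe]].
  rewrite linearZl_LR /= divfK ?addr0 ?subrr// dnorm_eq0.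
  by apply: contraNneq es0 => <-.
by rewrite linearZl_LR /= (oes f e) ?mulr0.
Qed.

Lemma gs_residual_sub (E : set H) es v : subspace E ->
  [set` es] `<=` E -> E v -> E (gs_residual dot es v).
Proof.
move=> sE esE Ev; apply: subspaceB => //; rewrite big_seq.
by apply: subspace_sum => // e ee; apply: subspaceZ => //; exact: esE.
Qed.

Lemma gs_residual_lspan es v : lspan [set` es] (v - gs_residual dot es v).
Proof.
rewrite /gs_residual opprB addrC subrK big_seq.
have sL := subspace_lspan [set` es].
by apply: subspace_sum => // e ee; apply: subspaceZ => //; exact: subset_lspan.
Qed.

Lemma gram_schmidt_orthogonal es vs : orthogonal_system es ->
  orthogonal_system (es ++ gram_schmidt dot es vs).
Proof.
elim: vs es => [|v vs IH] es oes /=; first by rewrite cats0.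
case: eqVneq => [_|w0]; first exact: IH.
rewrite -cat_rcons; apply/IH/orthogonal_system_rcons => //.
exact: gs_residual_orthogonal.
Qed.

Lemma gram_schmidt_sub (E : set H) es vs : subspace E ->
  [set` es] `<=` E -> [set` vs] `<=` E -> [set` gram_schmidt dot es vs] `<=` E.
Proof.
move=> sE; elim: vs es => [|v vs IH] es esE vsE //=.
have Ev : E v by apply: vsE; rewrite /= mem_head.
have vsE' : [set` vs] `<=` E by move=> u uv; apply: vsE; rewrite /= inE uv orbT.
case: eqVneq => [_|_]; first exact: IH.
have Ew := gs_residual_sub sE esE Ev.
move=> u /=; rewrite inE => /predU1P[->//|]; apply: IH => //.
by move=> e /=; rewrite mem_rcons inE => /predU1P[->|/esE].
Qed.

Lemma gram_schmidt_lspan es vs :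
  [set` vs] `<=` lspan [set` es ++ gram_schmidt dot es vs].
Proof.
elim: vs es => [|v vs IH] es //= u /=; rewrite inE.
case: (eqVneq (gs_residual _ _ _)) => [w0|w0]; last rewrite -cat_rcons; case/predU1P=> [->|/IH//].
  have := gs_residual_lspan es v; rewrite w0 subr0; apply: lspanS => e /= ee.
  by rewrite mem_cat ee.
set w := gs_residual dot es v; suff: lspan [set` rcons es w ++
  gram_schmidt dot (rcons es w) vs] (v - w + w) by rewrite subrK.
apply: subspaceD; first exact: subspace_lspan.
  have := gs_residual_lspan es v; apply: lspanS => e /= ee.
  by rewrite mem_cat mem_rcons inE ee orbT.
by apply: subset_lspan; rewrite /= mem_cat mem_rcons mem_head.
Qed.

(** Same recursion as [gram_schmidt], but keeping the input vector instead of its residual, so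
    inputs and outputs correspond one to one. *)
Fixpoint gs_select es vs : seq H :=
  if vs is v :: vs' then
    let w := gs_residual dot es v in
    if w == 0 then gs_select es vs' else v :: gs_select (rcons es w) vs'
  else [::].

Lemma size_gs_select es vs :
  size (gs_select es vs) = size (gram_schmidt dot es vs).
Proof. by elim: vs es => //= v vs IH es; case: eqP => _ /=; rewrite IH. Qed.

(** A discarded vector has residual 0, hence lies in the span of the current orthogonal list, and
    that list never leaves the span of [es] and the inputs already read. *)
Lemma mem_gs_select es us v vs : ~ lspan [set` es ++ us] v ->
  v \in gs_select es (us ++ v :: vs).
Proof.
elim: us es => [|u us IH] es /=.
  rewrite cats0 => nv; case: eqVneq => [w0|_]; last exact: mem_head.
  by have := gs_residual_lspan es v; rewrite w0 subr0.
move=> nv; case: eqVneq => [w0|_].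
  apply: IH; apply: contra_not nv; apply: lspanS => e /=.
  by rewrite !mem_cat inE => /orP[->//|->]; rewrite !orbT.
rewrite inE IH ?orbT//; apply: contra_not nv.
(* The residual appended to [es] is a combination of [es] and [u], so the span does not grow. *)
have sL := subspace_lspan [set` es ++ u :: us].
apply: lspan_min => // e /=; rewrite mem_cat mem_rcons inE -orbA.
case/or3P => [/eqP->|ee|ee].
- apply: gs_residual_sub => // [f fe|]; apply: subset_lspan.
    by rewrite /= mem_cat (fe : f \in es).
  by rewrite /= mem_cat mem_head orbT.
- by apply: subset_lspan; rewrite /= mem_cat ee.
- by apply: subset_lspan; rewrite /= mem_cat inE ee !orbT.
Qed.

(* Splitting by degree: the part of u of degree other than l is orthogonal to itself. *)
Lemma lspan_homogeneous (Hk : nat -> set H) (S : set H) l u :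
    hilbert_direct_sum dot Hk -> (forall v, S v -> homogeneous Hk v) ->
  Hk l u -> lspan S u -> lspan (S `&` Hk l) u.
Proof.
move=> [hsub hort _] homS Hu [m [c [g [Sg def_u]]]].
pose P i := `[< Hk l (g i) >].
pose u1 := \sum_(i | P i) c i *: g i.
pose u2 := \sum_(i | ~~ P i) c i *: g i.
have Eu : u = u1 + u2 by rewrite def_u (bigID P).
have H1 : Hk l u1.
  have [sH _] := hsub l.
  by apply: subspace_sum => // i /asboolP Hi; exact: subspaceZ.
have H2 : Hk l u2.
  have -> : u2 = u - u1 by rewrite Eu addrC addKr.
  by apply: subspaceB => //; have [] := hsub l.
have u20 : u2 = 0.
  apply/eqP; rewrite -(@dnorm_eq0 _ _ dot); apply/eqP.
  suff: [set v | dot u2 v = 0] u2 by [].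
  apply: subspace_sum (dot_subspacer u2) _ => i /asboolPn Hi /=.
  rewrite linearZr_LR /=; have [k Hki] := homS _ (Sg i).
  by rewrite (hort l k) ?mulr0// => lk; apply: Hi; rewrite lk.
rewrite Eu u20 addr0; have sL := subspace_lspan (S `&` Hk l).
apply: subspace_sum => // i /asboolP Hi; apply: subspaceZ => //.
exact: subset_lspan.
Qed.

End Orthogonality.

(** Positions in [s] are sent to positions in [t]. Repetitions in [s] are harmless, since [index]
    picks the first occurrence. *)
Lemma card_le_seq (U V : eqType) (s : seq U) (t : seq V) :
  uniq t -> (size s <= size t)%N -> ([set` s] #<= [set` t])%card.
Proof.
(* [nth] on [t] needs a default in [V], which may be empty; a member of [t] serves, and if there is
   none then [s] is empty as well. *)
move=> ut le_st; have [->|[d dt]] : s = [::] \/ exists d, d \in t.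
- case: s t ut le_st => [|v s] [|d t] //= _ _; [by left|by left|right].
  by exists d; rewrite mem_head.
- rewrite (_ : [set` [::]] = set0); first exact: card_ge0.
  by apply/seteqP; split.
pose f v := nth d t (index v s).
have lt_f v : v \in s -> (index v s < size t)%N.
  by move=> vs; apply: leq_trans le_st; rewrite index_mem.
apply: (@card_le_trans _ _ _ (f @` [set` s])).
  suff: (f @` [set` s] #= [set` s])%card by rewrite card_eq_le => /andP[].
  apply: inj_card_eq => u v; rewrite !inE /= => us vs.
  move/eqP; rewrite nth_uniq ?lt_f// => /eqP uv.
  by rewrite -(nth_index u us) uv nth_index.
apply: subset_card_le => _ [v vs <-] /=.
by apply: mem_nth; exact: lt_f.
Qed.

(** * Generated submodules and the lower bound on the number of generators *)

Section GeneratedSubmodule.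
Context {R : realType} {H : completeNormedModType R[i]} {n : nat}.
Variable T : 'I_n -> {linear H -> H}.
Hypothesis hTc : commuting_tuple T.
Implicit Types (G E : set H) (a : mpoly.multinom n) (u v : H).

(** These are the submodules over the polynomial ring, described without polynomials. *)
Definition invariant_subspace E :=
  subspace E /\ forall i v, E v -> E (T i v).

Definition monomials G : set H :=
  [set v | exists a g, G g /\ v = op_pow T a g].

Lemma op_pow0 v : op_pow T mpoly.mnm0 v = v.
Proof.
by rewrite /op_pow; elim: (enum 'I_n) => //= i l ->; rewrite mpoly.mnm0E.
Qed.

Lemma iter_op_comm i j p q v :
  iter p (T i) (iter q (T j) v) = iter q (T j) (iter p (T i) v).
Proof.
elim: p => //= p ->; elim: q => //= q <-; exact: hTc.
Qed.

Lemma op_powS i a v :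
  op_pow T (mpoly.mnm_add (mpoly.mnm1 i) a) v = T i (op_pow T a v).
Proof.
(* Over any list of indices the exponent raised at [i] yields one extra [T i] per occurrence of [i],
   moved to the front by commutation; [enum 'I_n] contains [i] exactly once. *)
rewrite /op_pow; transitivity (iter (count_mem i (enum 'I_n)) (T i)
    (foldr (fun i => iter (a i) (T i)) v (enum 'I_n))).
  elim: (enum 'I_n) => //= j l ->.
  rewrite mpoly.mnmDE mpoly.mnm1E eq_sym; case: eqVneq => [->|_].
    by rewrite -!iterD addnAC.
  exact: iter_op_comm.
by rewrite count_uniq_mem ?enum_uniq// mem_enum.
Qed.

Lemma op_pow_split a : a <> mpoly.mnm0 ->
  exists i a', a = mpoly.mnm_add (mpoly.mnm1 i) a'.
Proof.
move=> a0; have [i ai] : exists i, a i != 0%N.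
  apply: contrapT => /forallNP ai; apply: a0; apply/mpoly.mnmP => i.
  by rewrite mpoly.mnm0E; apply/eqP; move: (ai i) => /negP; rewrite negbK.
exists i, (mpoly.mnm_sub a (mpoly.mnm1 i)); apply/mpoly.mnmP => j.
rewrite mpoly.mnmDE mpoly.mnmBE mpoly.mnm1E subnKC//.
by case: eqVneq => // <-; rewrite lt0n.
Qed.

Lemma op_pow_invariant E a v :
  (forall i u, E u -> E (T i u)) -> E v -> E (op_pow T a v).
Proof.
move=> TE Ev; rewrite /op_pow; elim: (enum 'I_n) => //= i l El.
by elim: (a i) => //= m; exact: TE.
Qed.

(** Polynomials are traded for monomials: [op_eval] is a combination of monomials, and conversely a
    scaled monomial operator is the value of a one-term polynomial. *)
Lemma submodule_genE G : submodule_gen T G = lspan (monomials G).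
Proof.
apply/seteqP; split=> [_ [m [p [g [Gg ->]]]]|_ [m [c [g [Mg ->]]]]].
  have sL := subspace_lspan (monomials G).
  apply: subspace_sum => // i _; apply: subspace_sum => // a _.
  apply: subspaceZ => //; apply: subset_lspan.
  by exists a, (g i).
have /choice[ag /all_and2[Gg def_g]] : forall i, exists ag,
    G ag.2 /\ g i = op_pow T ag.1 ag.2.
  by move=> i; have [a [h [Gh ->]]] := Mg i; exists (a, h).
exists m, (fun i => c i *: mpoly.mpolyX R[i] (ag i).1), (fun i => (ag i).2).
split=> //; apply: eq_bigr => i _; rewrite def_g /op_eval.
(* Only for a non-zero coefficient is the support of the one-term polynomial a singleton. *)
have [->|c0] := eqVneq (c i) 0.
  by rewrite !scale0r mpoly.msupp0 big_nil.
by rewrite mpoly.msuppMCX// big_seq1 mpoly.mcoeffZ mpoly.mcoeffX eqxx mulr1.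
Qed.

Lemma subset_submodule_gen G : G `<=` submodule_gen T G.
Proof.
rewrite submodule_genE => g Gg; apply: subset_lspan.
by exists mpoly.mnm0, g; rewrite op_pow0.
Qed.

Lemma submodule_gen_invariant G : invariant_subspace (submodule_gen T G).
Proof.
rewrite submodule_genE; have [L0 LP] := subspace_lspan (monomials G).
split=> // i; apply: lspan_min.
  by split=> [|c u v /= Lu Lv]; rewrite /= ?linear0// linearP; exact: LP.
move=> _ [a [g [Gg ->]]]; rewrite /= -op_powS; apply: subset_lspan.
by exists (mpoly.mnm_add (mpoly.mnm1 i) a), g.
Qed.

Lemma submodule_gen_min G E :
  invariant_subspace E -> G `<=` E -> submodule_gen T G `<=` E.
Proof.
move=> [sE TE] GE; rewrite submodule_genE; apply: lspan_min => // v.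
by move=> [a [g [Gg ->]]]; apply: op_pow_invariant => //; exact: GE.
Qed.

Lemma op_pow_graded (gamma : 'I_n -> nat) (Hk : nat -> set H) l a v :
  (forall k i u, Hk k u -> Hk (k + gamma i)%N (T i u)) ->
  Hk l v -> Hk (l + weight gamma a)%N (op_pow T a v).
Proof.
move=> hT Hv; rewrite /weight -big_enum /op_pow /=.
elim: (enum 'I_n) => [|i s IH] /=; first by rewrite big_nil addn0.
rewrite big_cons addnCA addnC; elim: (a i) => [|m IHm] /=.
  by rewrite mul0n addn0.
by rewrite mulSnr addnA; exact: hT.
Qed.

Lemma weight_add1 (gamma : 'I_n -> nat) i a :
  weight gamma (mpoly.mnm_add (mpoly.mnm1 i) a) = (gamma i + weight gamma a)%N.
Proof.
rewrite /weight; under eq_bigr do rewrite mpoly.mnmDE mulnDl.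
rewrite big_split /= (bigD1 i)//= mpoly.mnm1E eqxx mul1n big1 ?addn0// => j ji.
by rewrite mpoly.mnm1E eq_sym (negPf ji).
Qed.

Lemma dot_op_pow0 (dot : {dot H for @Num.conj R[i]}) b a v :
    (forall i u, dot b (T i u) = 0) -> a <> mpoly.mnm0 ->
  dot b (op_pow T a v) = 0.
Proof. by move=> bT /op_pow_split[i [a' ->]]; rewrite op_powS. Qed.

(* Modulo the ranges of the T_i, to which es is orthogonal, only the constant
   coefficients of a representation of e in terms of G matter. *)
Lemma orthogonal_system_card_le (dot : {dot H for @Num.conj R[i]}) es G :
    orthogonal_system dot es ->
    {in es, forall e, forall i u, dot e (T i u) = 0} ->
    [set` es] `<=` submodule_gen T G ->
  ([set` es] #<= G)%card.
Proof.
move=> [ues es0 oes] oT esG.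
(* If [G] is infinite, it contains a copy of the natural numbers, into which the finite set [es]
   embeds. *)
have [[gs ugs def_G]|infG] :=
    pselect (exists2 s : seq H, uniq s & G = [set` s]); last first.
  apply: (@card_le_trans _ _ _ [set: nat]).
    exact/finite_set_countable/finite_seq.
  apply/infiniteP => /finite_seqP[s def_G]; apply: infG.
  exists (undup s); first exact: undup_uniq.
  by rewrite def_G; apply/seteqP; split=> v /=; rewrite mem_undup.
rewrite def_G; apply: card_le_seq => //.
pose es_ (i : 'I_(size es)) := nth 0 es i.
have es_in i : es_ i \in es by exact: mem_nth.
pose A := \matrix_(i < size gs, j < size es) dot (nth 0 gs i) (es_ j).
pose rowv v := \row_(j < size es) dot v (es_ j).
(* Monomials of positive degree pair to 0 with [es], and the constant monomial applied to a
   generator gives a row of [A]. *)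
have rowA v : submodule_gen T G v -> (rowv v <= A)%MS.
  rewrite submodule_genE; apply: (@lspan_min _ _ _ [set v | (rowv v <= A)%MS]).
    split=> [|c u w /= uA wA].
      by rewrite /= (_ : rowv 0 = 0) ?sub0mx//; apply/rowP => j; rewrite !mxE linear0l.
    rewrite (_ : rowv _ = c *: rowv u + rowv w) ?addmx_sub ?scalemx_sub//.
    by apply/rowP => j; rewrite !mxE linearDl linearZl_LR.
  move=> _ [a [g [Gg ->]]] /=.
  have [->|a0] := pselect (a = mpoly.mnm0).
    rewrite op_pow0; move: Gg; rewrite def_G /= => Gg.
    have gi : (index g gs < size gs)%N by rewrite index_mem.
    rewrite (_ : rowv g = row (Ordinal gi) A) ?row_sub//.
    by apply/rowP => j; rewrite !mxE /= nth_index.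
  rewrite (_ : rowv _ = 0) ?sub0mx//; apply/rowP => j; rewrite !mxE.
  by apply/dot_eq0C/dot_op_pow0 => //; exact: oT.
pose D := \matrix_(i < size es, j < size es) dot (es_ i) (es_ j).
have /submxP[X DX] : (D <= A)%MS.
  apply/row_subP => i; rewrite (_ : row i D = rowv (es_ i)).
    by apply: rowA; apply: esG; exact: es_in.
  by apply/rowP => j; rewrite !mxE.
(* The Gram matrix [D] is diagonal with non-zero diagonal, and [D'] is its inverse. From
   [D = X *m A] the product of [X] and [A *m D'] is the identity, which forces
   [size es <= size gs]. *)
pose D' := \matrix_(i < size es, j < size es) ((i == j)%:R / dot (es_ j) (es_ j)).
apply: (@mulmx1_min _ _ _ X (A *m D')); rewrite mulmxA -DX.
apply/matrixP => i j; rewrite !mxE (bigD1 j)//= big1 => [|l lj].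
  rewrite !mxE eqxx mul1r addr0; have [->|ij] := eqVneq i j.
    by rewrite mulfV// dnorm_eq0; apply: contraNneq es0 => <-.
  by rewrite oes ?mul0r// /es_ nth_uniq.
by rewrite !mxE (negPf lj) mul0r mulr0.
Qed.

End GeneratedSubmodule.

(** * Concatenation and linear independence of orthogonal systems *)

Section OrthogonalSystems.
Context {R : realType} {H : completeNormedModType R[i]}.
Variable dot : {dot H for @Num.conj R[i]}.
Implicit Types (es fs : seq H).

Lemma orthogonal_system_cat es fs : orthogonal_system dot (es ++ fs) <->
  [/\ orthogonal_system dot es, orthogonal_system dot fs &
      {in es & fs, forall u v, dot u v = 0}].
Proof.
split=> [[]|[[ues es0 oes] [ufs fs0 ofs] oef]].
  rewrite cat_uniq mem_cat negb_or => /and3P[ues /hasPn dis ufs] /andP[es0 fs0] o.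
  split; [split=> // u v ue ve|split=> // u v uf vf|move=> u v ue vf].
  - by apply: o; rewrite mem_cat ?ue ?ve.
  - by apply: o; rewrite mem_cat ?uf ?vf orbT.
  - apply: o; rewrite ?mem_cat ?ue ?vf ?orbT//.
    by apply: contraTneq ue => ->; exact: dis.
split.
(* A common member would be orthogonal to itself, hence 0, which [fs0] excludes. *)
- rewrite cat_uniq ues ufs andbT /=; apply/hasPn => u uf.
  apply: contra fs0 => ue; rewrite (_ : 0 = u)//; apply/eqP.
  by rewrite eq_sym -(@dnorm_eq0 _ _ dot) oef.
- by rewrite mem_cat negb_or es0.
- move=> u v; rewrite !mem_cat => /orP[ue|uf] /orP[ve|vf] uv.
  + exact: oes.
  + exact: oef.
  + by apply/dot_eq0C/oef.
  + exact: ofs.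
Qed.

Lemma orthogonal_system_flatten (I : eqType) (r : seq I) (f : I -> seq H) :
    uniq r -> (forall i, orthogonal_system dot (f i)) ->
    (forall i j u v, i <> j -> u \in f i -> v \in f j -> dot u v = 0) ->
  orthogonal_system dot (flatten [seq f i | i <- r]).
Proof.
move=> + of_ off; elim: r => [|i r IH] //= /andP[ir ur].
apply/orthogonal_system_cat; split; [exact: of_|exact: IH|].
move=> u v ui /flatten_mapP[j jr vj]; apply: off ui vj.
by move=> ij; move: ir; rewrite ij jr.
Qed.

Lemma orthogonal_system_lin_indep es :
  orthogonal_system dot es -> lin_indep [set` es].
Proof.
move=> [ues es0 oes] m c g ginj ges sum0 i.
have gi : g i \in es by exact: ges.
have : dot (\sum_j c j *: g j) (g i) = 0 by rewrite sum0 linear0l.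
rewrite linear_sumlz (bigD1 i)//= big1 => [|j ji].
  rewrite linearZl_LR addr0 => /eqP; rewrite mulf_eq0 dnorm_eq0.
  by case/orP => /eqP// gi0; move: es0; rewrite -gi0 gi.
rewrite linearZl_LR /= (oes (g j) (g i)) ?mulr0//; first exact: ges.
by rewrite (inj_eq ginj).
Qed.

End OrthogonalSystems.

(** * Density and degrees in the graded Hilbert space *)

Section GradedHilbert.
Context {R : realType} {H : completeNormedModType R[i]}.
Variables (dot : {dot H for @Num.conj R[i]}) (Hk : nat -> set H).
Hypotheses (hdot : hilbert_norm dot) (hHk : hilbert_direct_sum dot Hk).

Lemma subset_algebraic_sum l : Hk l `<=` algebraic_sum Hk.
Proof.
move=> v Hv; have [hsub _ _] := hHk.
(* The sum runs over [k < N], so degree [l] is reached only with [N = l.+1]. *)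
exists l.+1, (fun k => if k == l then v else 0); split.
  by move=> k; case: eqVneq => [->//|_]; have [[]] := hsub k.
rewrite big_ord_recr /= eqxx big1 ?add0r// => i _.
by rewrite ltn_eqF.
Qed.

(** The algebraic sum is dense: the partial sums of the decomposition of [h] lie in it and converge
    to [h]. *)
Lemma dot_algebraic_sum0 w h :
  (forall v, algebraic_sum Hk v -> dot w v = 0) -> dot w h = 0.
Proof.
move=> w0; have [_ _ /(_ h)[u [Hu uh]]] := hHk.
apply: (dot_cvg0 hdot uh) => N; apply: w0.
by exists N, u; split=> //; rewrite /series /= big_mkord.
Qed.

Lemma homogeneous_degree_unique k l v : Hk k v -> Hk l v -> v <> 0 -> k = l.
Proof.
move=> Hkv Hlv v0; apply: contrapT => kl; apply: v0; apply/eqP.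
rewrite -(@dnorm_eq0 _ _ dot); apply/eqP.
by have [_ hort _] := hHk; exact: hort kl Hkv Hlv.
Qed.

(** Boundedness makes [f] continuous, so [f h] is the limit of the images of the partial sums of
    [h], which are sums of images of homogeneous vectors. *)
Lemma dot_range_bounded0 (f : {linear H -> H}) b h :
  bounded_near f (nbhs (0 : H)) ->
  (forall l u, Hk l u -> dot b (f u) = 0) -> dot b (f h) = 0.
Proof.
move=> /bounded_linear_continuous fc b0; have [_ _ /(_ h)[u [Hu uh]]] := hHk.
have fuh : (f \o series u) N @[N --> \oo] --> f h.
  by apply: continuous_cvg => //; exact: fc.
apply: (dot_cvg0 hdot fuh) => N /=.
rewrite /series /= linear_sum.
suff : [set v | dot b v = 0] (\sum_(0 <= i < N) f (u i)) by [].
apply: subspace_sum (dot_subspacer dot b) _ => i _ /=.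
exact: b0 (Hu i).
Qed.

End GradedHilbert.

(** * A single stage of the construction *)

Section Stage.
Context {R : realType} {H : completeNormedModType R[i]} {n : nat}.
Variables (T : 'I_n -> {linear H -> H}).
Variables (dot : {dot H for @Num.conj R[i]}) (gamma : 'I_n -> nat).
Variables (r : nat) (k : 'I_r -> nat) (N : 'I_r -> nat).
Variables (B : 'I_r -> set H) (x : forall s : 'I_r, 'I_(N s) -> H).
Hypothesis hB : constructed T dot gamma k B x.

Lemma enum_ord_split m (j : 'I_m) : exists p q,
  enum 'I_m = p ++ j :: q /\ forall i, i \in p -> (i < j)%N.
Proof.
have lt_j : (j < size (enum 'I_m))%N by rewrite size_enum_ord.
exists (take j (enum 'I_m)), (drop j.+1 (enum 'I_m)); split.
  rewrite -{1}(cat_take_drop j (enum 'I_m)) (drop_nth j lt_j).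
  by rewrite nth_ord_enum.
move=> i /(map_f val); rewrite map_take val_enum_ord take_iota mem_iota /=.
by move=> lt_i; apply: leq_trans lt_i _; exact: geq_minl.
Qed.

(** Collects what later arguments use about stage [s], whether or not [B s] is empty. The list [xs]
    holds the inputs retained by Gram-Schmidt, hence has the length of [bs]. *)
Lemma constructed_stage s : exists bs xs : seq H,
  [/\ B s = [set` bs], orthogonal_system dot bs &
      forall b v, b \in bs -> Yset T gamma k B s v -> dot b v = 0] /\
  [/\ B s `<=` lspan (Yset T gamma k B s `|` range (x (s := s))),
      range (x (s := s)) `<=` lspan (Yset T gamma k B s `|` B s),
      size xs = size bs & Xprime T gamma k B x s `<=` [set` xs]].
Proof.
have [hB0 hB1] := hB s; set Y := Yset _ _ _ _ _ in hB0 hB1 *.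
have [inY|nY] := pselect (forall j, lspan Y (x (s := s) j)).
  exists [::], [::]; rewrite (hB0 inY); split; split=> //.
  - by apply/seteqP; split.
  - by move=> _ [j _ <-]; apply: lspanS (inY j) => v; left.
  - by move=> v [j [_ []]]; apply: lspanS (inY j) => u; left.
have [ys [def_Y def_B]] := hB1 nY.
have orth0 : orthogonal_system dot [::] by [].
set fs := gram_schmidt dot [::] ys in def_B.
set xs := [seq x j | j <- enum 'I_(N s)] in def_B.
have ofs : orthogonal_system dot fs by exact: gram_schmidt_orthogonal ys orth0.
have /orthogonal_system_cat[_ obs ofb] := gram_schmidt_orthogonal xs ofs.
have Yfs : Y `<=` lspan [set` fs].
  by rewrite -def_Y; exact: (@gram_schmidt_lspan _ _ dot [::]).
have fsY : [set` fs] `<=` lspan Y.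
  apply: gram_schmidt_sub => //; first exact: subspace_lspan.
  by rewrite def_Y; exact: subset_lspan.
exists (gram_schmidt dot fs xs), (gs_select dot fs xs); rewrite def_B.
split; split=> //.
- move=> b v bB Yv; apply: dot_lspan0 (Yfs _ Yv) => f ff.
  by apply/dot_eq0C/ofb.
- apply: gram_schmidt_sub; first exact: subspace_lspan.
    by move=> f /fsY; apply: lspanS => v; left.
  by move=> _ /mapP[j _ ->]; apply: subset_lspan; right; exists j.
- move=> _ [j _ <-]; have xj : x j \in xs by rewrite map_f ?mem_enum.
  apply: lspan_min (gram_schmidt_lspan dot fs xj); first exact: subspace_lspan.
  move=> v /=; rewrite mem_cat => /orP[/fsY|vB].
    by apply: lspanS => u; left.
  by apply: subset_lspan; right.
- exact: size_gs_select.
- move=> _ [j [-> xNY]] /=; rewrite /xs.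
  (* The inputs read before [x j] all have a smaller index, and [fs] lies in the span of [Y]; so
     [x j] is outside the span of [fs] and these inputs, and gets selected. *)
  have [p [q [-> ltp]]] := enum_ord_split j.
  rewrite map_cat; apply: mem_gs_select; apply: contra_not xNY.
  apply: lspan_min; first exact: subspace_lspan.
  move=> v /=; rewrite mem_cat => /orP[/fsY|/mapP[i ip ->]].
    by apply: lspanS => u; left.
  by apply: subset_lspan; right; exists i => //=; exact: ltp.
Qed.

End Stage.

(** * The whole construction: generation, wandering space and enumeration *)

Section Construction.
Context {R : realType} {H : completeNormedModType R[i]} {n : nat}.
Variables (dot : {dot H for @Num.conj R[i]}) (hdot : hilbert_norm dot).
Variables (Hk : nat -> set H) (hHk : hilbert_direct_sum dot Hk).
Variables (gamma : 'I_n -> nat) (hgamma : forall i, (0 < gamma i)%N).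
Variables (T : 'I_n -> {linear H -> H}) (hTb : bounded_tuple T).
Hypotheses (hTc : commuting_tuple T).
Hypothesis hTg : forall k i u, Hk k u -> Hk (k + gamma i)%N (T i u).
Variables (r : nat) (k : 'I_r -> nat).
Hypothesis hk : forall s t : 'I_r, (s < t)%N -> (k s < k t)%N.
Variables (N : 'I_r -> nat) (x : forall s : 'I_r, 'I_(N s) -> H).
Hypothesis hx : forall s j, Hk (k s) (@x s j).
Hypothesis hgen :
  generates T [set v | exists s j, v = @x s j] (algebraic_sum Hk).
Variables (B : 'I_r -> set H) (hB : constructed T dot gamma k B x).

Local Notation Y := (Yset T gamma k B).
Local Notation X' := (Xprime T gamma k B x).

Lemma stage_ind (P : 'I_r -> Prop) :
  (forall s : 'I_r, (forall p : 'I_r, (p < s)%N -> P p) -> P s) ->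
  forall s, P s.
Proof.
move=> IH s; have [m] := ubnP (val s); elim: m s => // m IHm s; rewrite ltnS => sm.
by apply: IH => p ps; apply: IHm; exact: leq_trans ps sm.
Qed.

Lemma stage_degree_inj s t : k s = k t -> s = t.
Proof.
move=> kst; apply: val_inj; case: (ltngtP s t) => // /hk.
  by rewrite kst ltnn.
by rewrite kst ltnn.
Qed.

Lemma Yset_invariant E (s : 'I_r) : invariant_subspace T E ->
  (forall p : 'I_r, (p < s)%N -> B p `<=` E) -> Y s `<=` E.
Proof.
move=> [_ TE] BE _ [p [y [a [ps By _ ->]]]].
by apply: op_pow_invariant => //; exact: BE By.
Qed.

(** By induction on the stage: the weight condition in [Yset] puts [Y s] in degree [k s], and [B s]
    lies in the span of [Y s] and the [x s j]. *)
Lemma constructed_homogeneous s : B s `<=` Hk (k s).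
Proof.
have [hsub _ _] := hHk.
elim/stage_ind: s => s IH b Bb.
have [_ [_ [_ [/(_ _ Bb) Lb _ _ _]]]] := constructed_stage hB s.
apply: lspan_min Lb; first by have [] := hsub (k s).
move=> _ [[p [y [a [ps By <- ->]]]]|[j _ <-]]; last exact: hx.
by apply: op_pow_graded => //; exact: IH By.
Qed.

Lemma algebraic_sum_sub E : invariant_subspace T E ->
  (forall s j, E (@x s j)) -> algebraic_sum Hk `<=` E.
Proof.
move=> iE xE; rewrite -hgen; apply: submodule_gen_min => // _ [s [j ->]].
exact: xE.
Qed.

Lemma algebraic_sum_invariant : invariant_subspace T (algebraic_sum Hk).
Proof. by rewrite -hgen; exact: submodule_gen_invariant. Qed.

Lemma constructed_sub : \bigcup_s B s `<=` algebraic_sum Hk.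
Proof.
move=> b [s _ Bb]; exact: (subset_algebraic_sum hHk (constructed_homogeneous Bb)).
Qed.

(** Each original generator lies in the span of [Y s] and [B s], and [Y s] consists of monomials
    applied to earlier [B p]. *)
Lemma constructed_generates :
  generates T (\bigcup_s B s) (algebraic_sum Hk).
Proof.
apply/seteqP; split.
  exact: submodule_gen_min algebraic_sum_invariant constructed_sub.
have iG := submodule_gen_invariant hTc (\bigcup_s B s).
have BG s : B s `<=` submodule_gen T (\bigcup_s B s).
  by move=> b Bb; apply: subset_submodule_gen; exists s.
apply: (algebraic_sum_sub iG) => s j.
have [_ [_ [_ [_ xL _ _]]]] := constructed_stage hB s.
apply: lspan_min (xL (x j) _); [exact: (proj1 iG)| |by exists j].
by move=> v [|/BG//]; apply: Yset_invariant.
Qed.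

Lemma Xprime_generates : generates T (\bigcup_s X' s) (algebraic_sum Hk).
Proof.
apply/seteqP; split.
  apply: submodule_gen_min algebraic_sum_invariant _ => _ [s _ [j [-> _]]].
  exact: (subset_algebraic_sum hHk (hx j)).
set E := submodule_gen _ _; have iE : invariant_subspace T E.
  exact: submodule_gen_invariant.
(* The claim on [B s] is carried along because [Y s] is built from earlier [B p]. Within a stage a
   second induction on [j] applies: an unselected vector lies in the span of [Y s] and its
   predecessors. *)
suff BxE s : B s `<=` E /\ forall j, E (@x s j).
  by apply: algebraic_sum_sub => // s; have [] := BxE s.
elim/stage_ind: s => s IH.
have YE : Y s `<=` E by apply: Yset_invariant => // p /IH[].
have xE j : E (@x s j).
  have [m] := ubnP (val j); elim: m j => // m IHm j; rewrite ltnS => jm.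
  have [L|nL] := pselect (lspan (Yset T gamma k B s `|`
      [set @x s i | i in [set i : 'I_(N s) | (i < j)%N]]) (x j)); last first.
    by apply: subset_submodule_gen => //; exists s => //; exists j.
  apply: lspan_min L; first by case: iE.
  by move=> _ [/YE//|[i /= ij <-]]; apply: IHm; exact: leq_trans ij jm.
split=> // b Bb; have [_ [_ [_ [/(_ _ Bb) Lb _ _ _]]]] := constructed_stage hB s.
apply: lspan_min Lb; first by case: iE.
by move=> _ [/YE//|[j _ <-]].
Qed.

Lemma dot_constructed_range0 s b i h : B s b -> dot b (T i h) = 0.
Proof.
move=> Bb; have [hsub hort _] := hHk; have Hb := constructed_homogeneous Bb.
apply: (dot_range_bounded0 hdot hHk) => [|l u Hu]; first exact: hTb.
have [kl|kl] := eqVneq (k s) (l + gamma i)%N; last first.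
  by apply: hort Hb (hTg i Hu); exact/eqP.
have [bs [_ [[def_B _ oY] _]]] := constructed_stage hB s.
(* It is enough to treat monomials applied to members of [B], and by [lspan_homogeneous] only those
   of degree [l]. *)
have Mu : lspan (monomials T (\bigcup_s B s)) u.
  rewrite -submodule_genE constructed_generates.
  exact: (subset_algebraic_sum hHk Hu).
have homM v : monomials T (\bigcup_s B s) v -> homogeneous Hk v.
  move=> [a [g [[p _ Bg] ->]]]; exists (k p + weight gamma a)%N.
  by apply: op_pow_graded => //; exact: constructed_homogeneous.
have := lspan_homogeneous hHk homM Hu Mu.
apply: (@lspan_min _ _ _ [set v | dot b (T i v) = 0]).
  split=> [|c v w /= v0 w0] /=; first by rewrite linear0 linear0r.
  by rewrite linearP linearDr linearZr_LR /= v0 w0 mulr0 addr0.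
move=> _ [[a [g [[p _ Bg] ->]]] Hg] /=.
(* A zero vector lies in every [Hk] and determines no degree, so it is set apart. *)
have [->|g0] := pselect (op_pow T a g = 0); first by rewrite linear0 linear0r.
have Ekp : (k p + weight gamma a)%N = l.
  apply: (homogeneous_degree_unique hHk _ Hg g0).
  by apply: op_pow_graded => //; exact: constructed_homogeneous.
(* Applying [T i] gives a monomial of degree [k s]; it belongs to [Y s], because [gamma i > 0]
   forces [g] to come from an earlier stage. *)
rewrite -op_powS//; apply: oY; first by move: Bb; rewrite def_B.
exists p, g, (mpoly.mnm_add (mpoly.mnm1 i) a); split=> //; last first.
  by rewrite weight_add1 kl -Ekp addnCA addnC.
have kps : (k p < k s)%N.
  by rewrite kl -Ekp -addnA -[X in (X < _)%N]addn0 ltn_add2l addn_gt0 hgamma orbT.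
rewrite ltnNge leq_eqVlt; apply/negP => /predU1P[/val_inj sp|/hk].
  by move: kps; rewrite sp ltnn.
by rewrite ltnNge ltnW.
Qed.

Lemma constructed_wandering : \bigcup_s B s `<=` wandering T dot.
Proof.
move=> b [s _ Bb] _ [h ->].
suff : [set v | dot b v = 0] (\sum_i T i (h i)) by [].
apply: subspace_sum (dot_subspacer dot b) _ => i _ /=.
exact: dot_constructed_range0 Bb.
Qed.

Lemma subspace_wandering : subspace (wandering T dot).
Proof.
split=> [v _|a u w Wu Ww v Sv]; first by rewrite linear0l.
by rewrite linearDl linearZl_LR /= Wu ?Ww ?mulr0 ?addr0.
Qed.

Lemma wandering_dot0 w i u : wandering T dot w -> dot w (T i u) = 0.
Proof.
apply; exists (fun j => if j == i then u else 0).
rewrite (bigD1 i)//= eqxx big1 ?addr0// => j /negPf ->.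
by rewrite linear0.
Qed.

(* The part of w orthogonal to the finite system es = B is orthogonal to B and
   to the ranges of the T_i, hence to the dense submodule generated by B. *)
Lemma lspan_constructed es : orthogonal_system dot es ->
  \bigcup_s B s = [set` es] -> lspan [set` es] = wandering T dot.
Proof.
move=> oes def_B; have esW : [set` es] `<=` wandering T dot.
  by rewrite -def_B; exact: constructed_wandering.
apply/seteqP; split; first exact: lspan_min subspace_wandering esW.
move=> w Ww; set w' := gs_residual dot es w.
have Ww' : wandering T dot w' by apply: gs_residual_sub subspace_wandering esW Ww.
suff w'0 : w' = 0 by have := gs_residual_lspan dot es w; rewrite -/w' w'0 subr0.
apply/eqP; rewrite -(@dnorm_eq0 _ _ dot); apply/eqP.
apply: (dot_algebraic_sum0 hdot hHk) => v.
rewrite -constructed_generates submodule_genE; apply: dot_lspan0 => {}v.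
move=> [a [g [Bg ->]]]; have [->|a0] := pselect (a = mpoly.mnm0); last first.
  by apply: dot_op_pow0 => // i u; exact: wandering_dot0.
rewrite op_pow0; apply: gs_residual_orthogonal => //.
by move: Bg; rewrite def_B.
Qed.

(** The lists of the stages are concatenated; distinct stages have distinct degrees, hence
    orthogonal vectors, and lengths add up. Repetitions in [xs] are allowed. *)
Lemma constructed_enumeration : exists es xs : seq H,
  [/\ orthogonal_system dot es, \bigcup_s B s = [set` es],
      size xs = size es & \bigcup_s X' s `<=` [set` xs]].
Proof.
have /choice[bx hbx] : forall s, exists bx : seq H * seq H,
  [/\ B s = [set` bx.1], orthogonal_system dot bx.1,
      size bx.2 = size bx.1 & X' s `<=` [set` bx.2]].
  move=> s; have [bs [xs [[? ? _] [_ _ ? ?]]]] := constructed_stage hB s.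
  by exists (bs, xs).
exists (flatten [seq (bx s).1 | s <- enum 'I_r]).
exists (flatten [seq (bx s).2 | s <- enum 'I_r]); split.
- apply: orthogonal_system_flatten => [|s|s t u v st us vt].
  + exact: enum_uniq.
  + by have [] := hbx s.
  + have [Bs _ _ _] := hbx s; have [Bt _ _ _] := hbx t.
    have [_ hort _] := hHk; apply: (hort (k s) (k t)).
    * by move/stage_degree_inj.
    * by apply: constructed_homogeneous; rewrite Bs.
    * by apply: constructed_homogeneous; rewrite Bt.
- apply/seteqP; split=> v /=.
    move=> [s _ Bv]; apply/flatten_mapP; exists s; rewrite ?mem_enum//.
    by have [Bs _ _ _] := hbx s; move: Bv; rewrite Bs.
  move=> /flatten_mapP[s _ vs]; exists s => //.
  by have [-> _ _ _] := hbx s.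
- rewrite !size_flatten /shape -!map_comp; congr sumn; apply: eq_map => s /=.
  by have [] := hbx s.
- move=> v [s _ Xv]; apply/flatten_mapP; exists s; rewrite ?mem_enum//.
  by have [_ _ _] := hbx s; apply.
Qed.

End Construction.

Theorem mainTheorem4 (R : realType) (H : completeNormedModType R[i])
    (dot : {dot H for @Num.conj R[i]}) (hdot : hilbert_norm dot)
    (Hk : nat -> set H) (hHk : hilbert_direct_sum dot Hk)
    (n : nat) (gamma : 'I_n -> nat) (hgamma : forall i, (0 < gamma i)%N)
    (T : 'I_n -> {linear H -> H}) (hTb : bounded_tuple T)
    (hTc : commuting_tuple T) (hTg : fg_graded T gamma Hk)
    (r : nat) (k : 'I_r -> nat)
    (hk : forall s t : 'I_r, (s < t)%N -> (k s < k t)%N)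
    (N : 'I_r -> nat) (hN : forall s, (0 < N s)%N)
    (x : forall s : 'I_r, 'I_(N s) -> H)
    (hx : forall s j, Hk (k s) (x s j)) (hx0 : forall s j, x s j <> 0)
    (hgen : generates T [set v | exists s j, v = x s j] (algebraic_sum Hk))
    (B : 'I_r -> set H) (hB : constructed T dot gamma k B x) :
  [/\ orthogonal_basis dot (\bigcup_s B s) (wandering T dot),
      minimal_generating_set T (\bigcup_s B s) (algebraic_sum Hk) &
      forall y, (\bigcup_s B s) y -> homogeneous Hk y] /\
  (minimal_generating_set T (\bigcup_s Xprime T gamma k B x s)
       (algebraic_sum Hk) /\
   \bigcup_s Xprime T gamma k B x s `<=` [set v | exists s j, v = x s j]).
Proof.
have [hT _] := hTg.
have [es [xs [oes def_B sz X'xs]]] := constructed_enumeration hHk hT hk hx hB.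
have Bgen := constructed_generates hHk hTc hT hx hgen hB.
(* This lower bound serves both minimality claims. *)
have Bcard G : generates T G (algebraic_sum Hk) -> ([set` es] #<= G)%card.
  move=> genG; apply: (orthogonal_system_card_le hTc oes) => [e ee i u|].
    have [s _ Be] : (\bigcup_s B s) e by rewrite def_B.
    exact: (dot_constructed_range0 hdot hHk hgamma hTb hTc hT hk hx hgen hB) Be.
  by rewrite genG -Bgen -def_B; exact: subset_submodule_gen.
have [ues es0 oes'] := oes.
split; [split|split; [split|]].
- split.
  + by rewrite def_B; exact: orthogonal_system_lin_indep oes.
  + rewrite def_B.
    exact: (lspan_constructed hdot hHk hgamma hTb hTc hT hk hx hgen hB oes).
  + by rewrite def_B => u v ue ve /eqP; apply: oes'.
- by split=> // G genG; rewrite def_B; exact: Bcard.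
- by move=> y [s _ By]; exists (k s); exact: (constructed_homogeneous hHk hT hx hB).
- exact: (Xprime_generates hHk hTc hx hgen hB).
(* The selected vectors lie in [xs], which is as long as [es], so there are at most as many of them
   as vectors in [B]. *)
- move=> G genG; apply: (card_le_trans (subset_card_le X'xs)).
  by apply: card_le_trans (Bcard G genG); apply: card_le_seq => //; rewrite sz.
- by move=> _ [s _ [j [-> _]]]; exists s, j.
Qed.
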